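(* For $n \geq 3$, $\mathscr{C}_n$ is a ranked poset. A tree is a maximal element of $\mathscr{C}_n$ if and only if it is of rank $n-2$ in $\mathscr{C}_n$ (or equivalently, if and only if its right arm has length $1$). In particular, the left comb tree is in the maximal rank of $\mathscr{C}_n$. Furthermore, for $0 \leq r \leq n-2$, the number $|Q_r|$ of elements of rank $r$ in $\mathscr{C}_n$ is $$|Q_r| = \binom{n+r-2}{r} - \binom{n+r-2}{r-1}.$$
   Context: $\mathbb{T}_n$ is the set of all full plane binary trees with $n$ leaves (every internal vertex has exactly a left child and a right child); the leaves are labeled $a_1,\ldots,a_n$ from left to right. For $T\in\mathbb{T}_n$, the reduced parenthesization $RP_T$ is the set of all subsets of $\{a_1,\ldots,a_n\}$ which are leaf sets of the subtrees of $T$ rooted at vertices of $T$ and which do not contain $a_n$. The (right) comb poset $\mathscr{C}_n$ is the set $\mathbb{T}_n$ ordered by $T_1\le T_2$ if and only if $RP_{T_1}\subseteq RP_{T_2}$. Its unique minimal element is the right comb tree $\mathrm{RCT}(n)$, the tree $a_1(a_2(\cdots(a_{n-1}a_n)\cdots))$, for which $RP_T$ contains only singletons. Ranked means that for every $T$ all maximal chains from $\mathrm{RCT}(n)$ to $T$ have the same length, which is the rank of $T$; $Q_r$ is the set of elements of rank $r$. The left comb tree is $(((\cdots((a_1a_2)a_3)\cdots)a_{n-2})a_{n-1})a_n$. The right arm of $T$ is the path induced by the vertices of $T$ that lie in the left subtree of no other vertex of $T$ (the path from the root to $a_n$); its length is its number of edges. Convention: $\binom{m}{-1}=0$. *)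

(* Defs.v *)
From HB Require Import structures.
From mathcomp Require Import all_boot all_order all_algebra.
Set Implicit Arguments.
Unset Strict Implicit.
Unset Printing Implicit Defensive.

Import Order.Theory.

Inductive btree : Type := Leaf | Node of btree & btree.

Fixpoint nleaves (t : btree) : nat :=
  if t is Node l r then nleaves l + nleaves r else 1.

Fixpoint tree_code (t : btree) : GenTree.tree unit :=
  if t is Node l r then GenTree.Node 0 [:: tree_code l; tree_code r]
  else GenTree.Leaf tt.

Fixpoint tree_decode (c : GenTree.tree unit) : btree :=
  if c is GenTree.Node _ [:: l; r] then Node (tree_decode l) (tree_decode r)
  else Leaf.

Lemma tree_codeK : cancel tree_code tree_decode.
Proof. by elim=> //= l -> r ->. Qed.

HB.instance Definition _ := Countable.copy btree (can_type tree_codeK).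

Lemma nleaves_gt0 (t : btree) : 0 < nleaves t.
Proof. by elim: t => //= l Hl r Hr; rewrite addn_gt0 Hl. Qed.

Record tree_of (n : nat) : Type :=
  TreeOf { shape :> btree; _ : nleaves shape == n }.

HB.instance Definition _ n := [isSub for @shape n].
HB.instance Definition _ n := [Countable of tree_of n by <:].

Fixpoint trees_upto (h : nat) : seq btree :=
  if h is h'.+1 then
    Leaf :: [seq Node l r | l <- trees_upto h', r <- trees_upto h']
  else [:: Leaf].

Lemma mem_trees_upto (h : nat) (t : btree) :
  nleaves t <= h.+1 -> t \in trees_upto h.
Proof.
elim: h t => [|h IH] [|l r] //= le_h.
  by have := nleaves_gt0 l; have := nleaves_gt0 r; case: (nleaves l) le_h => // a;
     case: (nleaves r) => // b; rewrite addSn addnS.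
rewrite inE /=; apply/allpairsP; exists (l, r); split=> //=; apply: IH.
  by rewrite -ltnS (leq_trans _ le_h) // -{1}[nleaves l]addn0 ltn_add2l nleaves_gt0.
by rewrite -ltnS (leq_trans _ le_h) // -{1}[nleaves r]add0n ltn_add2r nleaves_gt0.
Qed.

Definition tree_enum (n : nat) : seq (tree_of n) :=
  undup (pmap insub (trees_upto n)).

Lemma tree_enumP (n : nat) : Finite.axiom (tree_enum n).
Proof.
apply: Finite.uniq_enumP; first exact: undup_uniq.
move=> T; rewrite mem_undup mem_pmap_sub; apply: mem_trees_upto.
by case: T => t /= /eqP ->.
Qed.

HB.instance Definition _ n := isFinite.Build (tree_of n) (@tree_enumP n).

(* The label a_(i+1) is represented by i : 'I_n.  [leafsets n k t] lists the
   leaf sets of the subtrees rooted at all the vertices of t, when the leaves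
   of t are labeled from left to right starting with k : 'I_n. *)
Fixpoint leafsets (n k : nat) (t : btree) : seq {set 'I_n} :=
  [set i : 'I_n | k <= i < k + nleaves t] ::
  if t is Node l r then leafsets n k l ++ leafsets n (k + nleaves l) r
  else [::].

(* a_n is the element of 'I_n with value n - 1. *)
Definition RP (n : nat) (T : tree_of n) : {set {set 'I_n}} :=
  [set A in leafsets n 0 T | [forall i in A, i.+1 != n]].

Lemma leafsets_sub (n k : nat) (t : btree) (A : {set 'I_n}) (i : 'I_n) :
  A \in leafsets n k t -> i \in A -> k <= i < k + nleaves t.
Proof.
elim: t k => [|l IHl r IHr] k /=; rewrite inE; first by move=> /eqP ->; rewrite inE.
move=> /predU1P[-> |]; first by rewrite inE.
rewrite mem_cat => /orP[Al|Ar] iA.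
  have /andP[-> lt_i] := IHl _ Al iA.
  by rewrite (leq_trans lt_i) // leq_add2l leq_addr.
have /andP[le_i lt_i] := IHr _ Ar iA.
by rewrite addnA lt_i (leq_trans _ le_i) // leq_addr.
Qed.

Lemma leafsets_neq0 (n k : nat) (t : btree) (A : {set 'I_n}) :
  k + nleaves t <= n -> A \in leafsets n k t -> exists i, i \in A.
Proof.
elim: t k => [|l IHl r IHr] k le_n /=; rewrite inE.
  move=> /eqP ->; rewrite /= addn1 in le_n; exists (Ordinal le_n).
  by rewrite inE /= leqnn addn1 ltnS leqnn.
move=> /predU1P[-> |].
  have lt_k : k < n.
    by rewrite (leq_trans _ le_n) // -{1}[k]addn0 ltn_add2l nleaves_gt0.
  exists (Ordinal lt_k); rewrite inE /= leqnn /=.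
  by rewrite -{1}[k]addn0 ltn_add2l (nleaves_gt0 (Node l r)).
rewrite mem_cat => /orP[]; first apply: IHl; last apply: IHr.
  by rewrite (leq_trans _ le_n) //= leq_add2l leq_addr.
by rewrite -addnA.
Qed.

Lemma leafsets_root (n k : nat) (t : btree) :
  [set i : 'I_n | k <= i < k + nleaves t] \in leafsets n k t.
Proof. by case: t => [|l r]; rewrite /= inE eqxx. Qed.

Definition avoids (n m : nat) (A : {set 'I_n}) := [forall i in A, i.+1 != m].

Lemma leafsets_left (n k : nat) (l r l' r' : btree) :
    nleaves l + nleaves r = nleaves l' + nleaves r' ->
    k + (nleaves l + nleaves r) <= n ->
    (forall A : {set 'I_n}, avoids (k + (nleaves l + nleaves r)) A ->
       A \in leafsets n k (Node l r) -> A \in leafsets n k (Node l' r')) ->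
  nleaves l <= nleaves l'.
Proof.
move=> E le_n sub.
have l0 := nleaves_gt0 l; have r0 := nleaves_gt0 r.
have k_lt : k < n by rewrite (leq_trans _ le_n) // -{1}[k]addn0 ltn_add2l addn_gt0 l0.
have m_lt : (k + nleaves l).-1 < n.
  rewrite prednK ?addn_gt0 ?l0 ?orbT // (leq_trans _ le_n) // leq_add2l.
  exact: leq_addr.
set B := [set i : 'I_n | k <= i < k + nleaves l].
have mB : Ordinal m_lt \in B.
  rewrite inE /= -ltnS prednK ?addn_gt0 ?l0 ?orbT //.
  by rewrite leqnn andbT -{1}[k]addn0 ltn_add2l.
have kB : Ordinal k_lt \in B by rewrite inE /= leqnn -{1}[k]addn0 ltn_add2l.
have /sub : avoids (k + (nleaves l + nleaves r)) B.
  apply/forall_inP=> i; rewrite inE => /andP[_ lt_i].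
  rewrite neq_ltn (leq_ltn_trans lt_i) // ltn_add2l -{1}[nleaves l]addn0.
  by rewrite ltn_add2l.
rewrite /= inE mem_cat leafsets_root orbT => /(_ isT).
rewrite inE mem_cat => /or3P[/eqP EB|Bl|Br].
- have le_n1 : k + (nleaves l + nleaves r) = (k + (nleaves l + nleaves r)).-1.+1.
    by rewrite prednK // addn_gt0 addn_gt0 l0 orbT.
  have z_lt : (k + (nleaves l + nleaves r)).-1 < n by rewrite -le_n1.
  have : Ordinal z_lt \in B.
    rewrite EB inE /= -E -[_.-1 < _]/(_.-1.+1 <= _) -le_n1 leqnn andbT.
    by rewrite -ltnS -le_n1 -{1}[k]addn0 ltn_add2l addn_gt0 l0.
  rewrite inE /= => /andP[_]; rewrite -[_.-1 < _]/(_.-1.+1 <= _) -le_n1.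
  by rewrite leq_add2l -{2}[nleaves l]addn0 leq_add2l leqNgt r0.
- have /andP[_] := leafsets_sub Bl mB.
  by rewrite /= prednK ?addn_gt0 ?l0 ?orbT // leq_add2l.
have /andP[] := leafsets_sub Br kB.
by rewrite /= -{2}[k]addn0 leq_add2l leqNgt nleaves_gt0.
Qed.

Lemma leafsets_children (n k : nat) (l r l' r' : btree) :
    nleaves l = nleaves l' -> nleaves r = nleaves r' ->
    k + (nleaves l + nleaves r) <= n ->
    (forall A : {set 'I_n}, avoids (k + (nleaves l + nleaves r)) A ->
       A \in leafsets n k (Node l r) -> A \in leafsets n k (Node l' r')) ->
  (forall A, A \in leafsets n k l -> A \in leafsets n k l') /\
  (forall A, avoids (k + nleaves l + nleaves r) A ->
     A \in leafsets n (k + nleaves l) r -> A \in leafsets n (k + nleaves l) r').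
Proof.
move=> El Er le_n sub; have r0 := nleaves_gt0 r; have l0 := nleaves_gt0 l.
have z1 : k + (nleaves l + nleaves r) = (k + (nleaves l + nleaves r)).-1.+1.
  by rewrite prednK // addn_gt0 addn_gt0 l0 orbT.
have z_lt : (k + (nleaves l + nleaves r)).-1 < n by rewrite -z1.
have zR : Ordinal z_lt \in
    [set i : 'I_n | k <= i < k + nleaves (Node l' r')].
  rewrite inE /= -El -Er -[_.-1 < _]/(_.-1.+1 <= _) -z1 leqnn andbT.
  by rewrite -ltnS -z1 -{1}[k]addn0 ltn_add2l addn_gt0 l0.
have nroot A : avoids (k + (nleaves l + nleaves r)) A ->
    A != [set i : 'I_n | k <= i < k + nleaves (Node l' r')].
  move=> /forall_inP av; apply/eqP=> EA; have := av (Ordinal z_lt).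
  by rewrite EA => /(_ zR); rewrite /= -z1 eqxx.
split=> [A Al|A av Ar].
  have av : avoids (k + (nleaves l + nleaves r)) A.
    apply/forall_inP=> i iA; have /andP[_ lt_i] := leafsets_sub Al iA.
    rewrite neq_ltn (leq_ltn_trans lt_i) // ltn_add2l -{1}[nleaves l]addn0.
    by rewrite ltn_add2l.
  have := sub A av; rewrite /= inE mem_cat Al orbT => /(_ isT).
  rewrite inE (negPf (nroot A av)) /= mem_cat => /orP[//|Ar'].
  have [|i iA] := leafsets_neq0 _ Al.
    by rewrite (leq_trans _ le_n) // leq_add2l leq_addr.
  have /andP[_ lt_i] := leafsets_sub Al iA.
  by have /andP[] := leafsets_sub Ar' iA; rewrite -El leqNgt lt_i.
rewrite -addnA in av.
have := sub A av; rewrite /= inE mem_cat Ar !orbT => /(_ isT).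
rewrite inE (negPf (nroot A av)) /= mem_cat -El => /orP[Al'|//].
have [|i iA] := leafsets_neq0 _ Ar; first by rewrite -addnA.
have /andP[le_i _] := leafsets_sub Ar iA.
by have /andP[_] := leafsets_sub Al' iA; rewrite -El ltnNge le_i.
Qed.

Lemma leafsets_inj (n k : nat) (t t' : btree) :
    nleaves t = nleaves t' -> k + nleaves t <= n ->
    (forall A : {set 'I_n}, avoids (k + nleaves t) A ->
       (A \in leafsets n k t) = (A \in leafsets n k t')) ->
  t = t'.
Proof.
elim: t k t' => [|l IHl r IHr] k [|l' r'] //=.
- by have := nleaves_gt0 l'; have := nleaves_gt0 r';
    case: (nleaves l') => // a; case: (nleaves r') => // b; rewrite addSn addnS.
- by have := nleaves_gt0 l; have := nleaves_gt0 r;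
    case: (nleaves l) => // a; case: (nleaves r) => // b; rewrite addSn addnS.
move=> E le_n eqA.
have sub A : avoids (k + (nleaves l + nleaves r)) A ->
    A \in leafsets n k (Node l r) -> A \in leafsets n k (Node l' r').
  by move=> av; rewrite /= (eqA A av).
have sub' A : avoids (k + (nleaves l' + nleaves r')) A ->
    A \in leafsets n k (Node l' r') -> A \in leafsets n k (Node l r).
  by rewrite -E => av; rewrite /= (eqA A av).
have le_n' : k + (nleaves l' + nleaves r') <= n by rewrite -E.
have El : nleaves l = nleaves l'.
  by apply/eqP; rewrite eqn_leq (leafsets_left E le_n sub)
    (leafsets_left (esym E) le_n' sub').
have Er : nleaves r = nleaves r' by move: E; rewrite El => /addnI.
have [subl subr] := leafsets_children El Er le_n sub.
have [subl' subr'] := leafsets_children (esym El) (esym Er) le_n' sub'.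
congr Node.
  apply: (IHl k) => // [|A _]; last by apply/idP/idP; [apply: subl|apply: subl'].
  by rewrite (leq_trans _ le_n) // leq_add2l leq_addr.
apply: (IHr (k + nleaves l)) => // [|A av]; first by rewrite -addnA.
by apply/idP/idP; [apply: subr|rewrite El; apply: subr'; rewrite -El -Er].
Qed.

Lemma RP_inj (n : nat) : injective (@RP n).
Proof.
move=> T1 T2 E; apply: val_inj.
have E1 : nleaves T1 = n by case: T1 {E} => t /= /eqP.
have E2 : nleaves T2 = n by case: T2 {E} => t /= /eqP.
apply: (@leafsets_inj n 0); rewrite ?E1 ?E2 ?add0n // => A av.
by have /setP/(_ A) := E; rewrite !inE -/(avoids n A) av !andbT.
Qed.

Definition comb_le (n : nat) (T1 T2 : tree_of n) : bool := RP T1 \subset RP T2.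

Lemma comb_le_refl (n : nat) : reflexive (@comb_le n).
Proof. by move=> T; apply: subxx. Qed.

Lemma comb_le_anti (n : nat) : antisymmetric (@comb_le n).
Proof. by move=> T1 T2; rewrite /comb_le -eqEsubset => /eqP /RP_inj. Qed.

Lemma comb_le_trans (n : nat) : transitive (@comb_le n).
Proof. by move=> T2 T1 T3; apply: subset_trans. Qed.

Fact comb_display : Order.disp_t.
Proof. exact: Order.Disp tt tt. Qed.

(* The comb poset C_n: [tree_of n] is a [finPOrderType] from here on. *)
HB.instance Definition _ n := Order.Le_isPOrder.Build comb_display (tree_of n)
  (@comb_le_refl n) (@comb_le_anti n) (@comb_le_trans n).

Fixpoint right_comb (n : nat) : btree :=
  if n is (_.+1 as m).+1 then Node Leaf (right_comb m) else Leaf.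

Fixpoint left_comb (n : nat) : btree :=
  if n is (_.+1 as m).+1 then Node (left_comb m) Leaf else Leaf.

Lemma nleaves_right_comb (n : nat) : 0 < n -> nleaves (right_comb n) == n.
Proof. by elim: n => [|[|n] IH] //= _; rewrite (eqP (IH isT)). Qed.

Lemma nleaves_left_comb (n : nat) : 0 < n -> nleaves (left_comb n) == n.
Proof. by elim: n => [|[|n] IH] //= _; rewrite (eqP (IH isT)) addn1. Qed.

Definition RCT (n : nat) (n_gt0 : 0 < n) : tree_of n :=
  TreeOf (nleaves_right_comb n_gt0).

Definition LCT (n : nat) (n_gt0 : 0 < n) : tree_of n :=
  TreeOf (nleaves_left_comb n_gt0).

(* Number of edges on the path from the root to the rightmost leaf, i.e. of the
   path that never steps to a left child. *)
Fixpoint right_arm_length (t : btree) : nat :=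
  if t is Node _ r then (right_arm_length r).+1 else 0.

Section RankedPosets.
Local Open Scope order_scope.

Definition is_maximal d (P : finPOrderType d) (x : P) : Prop :=
  forall y : P, x <= y -> y = x.

Definition chain_between d (P : finPOrderType d) (a b : P) (C : {set P}) : bool :=
  [&& a \in C, b \in C,
      [forall x in C, a <= x <= b] &
      [forall x in C, forall y in C, x >=< y]].

Definition maximal_chain d (P : finPOrderType d) (a b : P) (C : {set P}) : bool :=
  maxset (chain_between a b) C.

Definition chain_length d (P : finPOrderType d) (C : {set P}) : nat := #|C|.-1.

Definition ranked_from d (P : finPOrderType d) (a : P) : Prop :=
  forall (x : P) (C1 C2 : {set P}),
    maximal_chain a x C1 -> maximal_chain a x C2 ->
    chain_length C1 = chain_length C2.

(* When [ranked_from a] holds, all the terms of this maximum are equal. *)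
Definition rank_from d (P : finPOrderType d) (a x : P) : nat :=
  \max_(C : {set P} | maximal_chain a x C) chain_length C.

End RankedPosets.

Definition Q (n : nat) (n_gt0 : 0 < n) (r : nat) : {set tree_of n} :=
  [set T | rank_from (RCT n_gt0) T == r].

(* The binomial coefficient (m choose r - 1), equal to 0 when r = 0. *)
Definition bin_pred (m r : nat) : nat := if r is s.+1 then 'C(m, s) else 0.

(* Main.v *)
Require Import Defs.
From mathcomp Require Import all_boot all_order all_algebra.
From mathcomp Require Import zify.

(** Write T = L_1 (L_2 (... (L_k a_n))), where k is the length of the right arm.
    Then RP_T consists of the leaf sets of the vertices of the L_i, so that
    |RP_T| = 2 (n - 1) - k and n - 1 - k is strictly increasing in T.  If
    T < T', the leaf set of some left subtree M = A B hanging from the right arm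
    of T' is not in RP_T, and replacing M R by A (B R) in T' removes exactly this
    set from RP_T'; hence maximal chains skip no value of n - 1 - k, which is
    therefore the rank.  For the counting, let f (n, k) be the number of trees
    with right arm of length k.  L_1 is either a leaf, which can be deleted, or
    of the form A B, to which the same rotation applies; this gives
    f (n, k) = f (n - 1, k - 1) + f (n, k + 1), a recurrence that the ballot
    numbers satisfy by Pascal's rule. *)

Import Order.Theory.

Set Implicit Arguments.
Unset Strict Implicit.
Unset Printing Implicit Defensive.

(** * Maximal chains in a finite poset with a grading function *)

Section GradedChains.
Local Open Scope order_scope.

Variables (d : Order.disp_t) (P : finPOrderType d) (a : P) (rho : P -> nat).
Hypothesis a_le : forall x, a <= x.
Hypothesis rho_lt : forall x y, x < y -> (rho x < rho y)%N.
Hypothesis rho_a : rho a = 0%N.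
Hypothesis rho_pred :
  forall x y, x < y -> exists z, [/\ x <= z, z < y & rho y = (rho z).+1].

(** Values are reached downwards from [x]. Below a [y] of [C], take the [w] of [C] with the largest
    [rho]; the [z] of [rho_pred] between [w] and [y] is comparable with all of [C], so maximality
    puts it in [C]. *)
Lemma maximal_chain_rho (x : P) (C : {set P}) (v : nat) :
  maximal_chain a x C -> (v <= rho x)%N -> exists2 c, c \in C & rho c = v.
Proof.
move=> /maxsetP [/and4P[aC xC /forall_inP boundC /forall_inP cmpC] maxC].
have cmp y z : y \in C -> z \in C -> (y <= z) || (z <= y).
  by move=> yC zC; have /forall_inP/(_ _ zC) := cmpC _ yC.
move=> le_v; rewrite -(subKn le_v); elim: (rho x - v)%N => [|j [y yC rho_y]].
  by exists x; rewrite // subn0.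
(* Here the truncated difference [rho x - j.+1] is 0, the value at [a]. *)
have [le_j|lt_j] := leqP (rho x) j.
  exists a; rewrite // rho_a; lia.
have lt_ay : a < y.
  by rewrite lt_neqAle a_le andbT; apply/eqP => ay; move: rho_y; rewrite -ay; lia.
pose below := [pred w | (w \in C) && (w < y)].
have below_a : below a by rewrite /= aC.
case: (arg_maxnP rho below_a) => w /andP[wC lt_wy] max_w.
have [z [le_wz lt_zy rho_z]] := rho_pred lt_wy.
suff <- : z |: C = C.
  by exists z; [exact: setU11 | move: rho_y; rewrite rho_z; lia].
have cmp_z c : c \in C -> (c <= z) || (y <= c).
  move=> cC; case/orP: (cmp _ _ cC yC) => [|->]; last by rewrite orbT.
  rewrite le_eqVlt => /predU1P[->|lt_cy]; first by rewrite lexx orbT.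
  suff le_cw : c <= w by rewrite (le_trans le_cw le_wz).
  have := max_w c; rewrite /= cC lt_cy => /(_ isT) le_rho.
  case/orP: (cmp _ _ cC wC) => //; rewrite le_eqVlt => /predU1P[->|/rho_lt] //.
  by rewrite ltnNge le_rho.
apply: maxC; last exact: subsetU1.
have /andP[_ le_yx] := boundC _ yC.
apply/and4P; split; rewrite ?inE ?aC ?xC ?orbT //.
  apply/forall_inP => c /setU1P[->|/boundC //].
  by rewrite a_le (le_trans (ltW lt_zy) le_yx).
have cmp_zC c : c \in C -> (c <= z) || (z <= c).
  by move=> /cmp_z /orP[->|le_yc] //; rewrite (le_trans (ltW lt_zy) le_yc) orbT.
apply/forall_inP => c1 /setU1P[->|c1C]; apply/forall_inP => c2 /setU1P[->|c2C].
- by rewrite comparablexx.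
- by rewrite /Order.comparable orbC cmp_zC.
- exact: cmp_zC.
- exact: cmp.
Qed.

(** On a chain [rho] is injective, and it takes every value from 0 to [rho x], so [C] has
    [rho x + 1] elements. *)
Lemma maximal_chain_length (x : P) (C : {set P}) :
  maximal_chain a x C -> chain_length C = rho x.
Proof.
move=> maxC; have surj := maximal_chain_rho maxC.
have /maxsetP [/and4P[aC xC /forall_inP boundC /forall_inP cmpC] _] := maxC.
have rho_mono y z : y <= z -> (rho y <= rho z)%N.
  by rewrite le_eqVlt => /predU1P[->|/rho_lt /ltnW].
pose f y : 'I_(rho x).+1 := inord (rho y).
have rhoE y : y \in C -> rho y = f y.
  by move=> /boundC /andP[_ /rho_mono le_y]; rewrite inordK.
have f_inj : {in C &, injective f}.
  move=> y z yC zC fyz.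
  have rho_yz : rho y = rho z by rewrite (rhoE y yC) (rhoE z zC) fyz.
  have /forall_inP/(_ _ zC) := cmpC _ yC.
  by case/comparable_ltgtP => // /rho_lt; rewrite rho_yz ltnn.
have imC : f @: C = setT.
  apply/eqP; rewrite -subTset; apply/subsetP => i _; apply/imsetP.
  have [c cC rho_c] := surj i (ltn_ord i).
  by exists c => //; apply: val_inj; rewrite /= -rhoE.
by rewrite /chain_length -(card_in_imset f_inj) imC cardsT card_ord.
Qed.

Lemma ranked_from_rho : ranked_from a.
Proof. by move=> x C1 C2 /maximal_chain_length -> /maximal_chain_length ->. Qed.

Lemma rank_from_rho (x : P) : rank_from a x = rho x.
Proof.
(* Extending this chain to a maximal one shows that the maximum in [rank_from] is not over an empty
   family. *)
have chain0 : chain_between a x [set a; x].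
  apply/and4P; split; rewrite ?inE ?eqxx ?orbT //.
    by apply/forall_inP => y /set2P[]->; rewrite lexx a_le.
  apply/forall_inP => y /set2P[]->; apply/forall_inP => z /set2P[]->;
  by rewrite /Order.comparable ?lexx ?a_le ?orbT.
have [C maxC _] := maxset_exists chain0.
apply/eqP; rewrite eqn_leq; apply/andP; split.
  by apply/bigmax_leqP => D /maximal_chain_length ->.
by rewrite -(maximal_chain_length maxC) /rank_from leq_bigmax_cond.
Qed.

End GradedChains.

(** * Leaf sets as intervals of integers *)

(* The pair (i, j) stands for the leaf set {i, ..., j - 1}. *)
Fixpoint intervals (k : nat) (t : btree) : seq (nat * nat) :=
  (k, k + nleaves t) ::
  if t is Node l r then intervals k l ++ intervals (k + nleaves l) r else [::].

(** The vertices of the right arm are skipped, since their leaf sets contain the last leaf; for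
    [k = 0] this encodes the reduced parenthesization. *)
Fixpoint left_intervals (k : nat) (t : btree) : seq (nat * nat) :=
  if t is Node l r then intervals k l ++ left_intervals (k + nleaves l) r
  else [::].

Definition ord_interval (n : nat) (p : nat * nat) : {set 'I_n} :=
  [set i : 'I_n | p.1 <= i < p.2].

Lemma leafsetsE (n k : nat) (t : btree) :
  leafsets n k t = map (@ord_interval n) (intervals k t).
Proof. by elim: t k => //= l IHl r IHr k; rewrite map_cat IHl IHr. Qed.

Lemma intervals_root (k : nat) (t : btree) :
  (k, k + nleaves t) \in intervals k t.
Proof. by case: t => *; rewrite inE eqxx. Qed.

Lemma intervals_bound (k : nat) (t : btree) (p : nat * nat) :
  p \in intervals k t -> [/\ k <= p.1, p.1 < p.2 & p.2 <= k + nleaves t].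
Proof.
elim: t k => [|l IHl r IHr] k /=; rewrite inE; first by move=> /eqP ->; split=> /=; lia.
have := nleaves_gt0 l; have := nleaves_gt0 r.
move=> ? ? /predU1P[->|]; first by split=> /=; lia.
by rewrite mem_cat => /orP[/IHl|/IHr] []; split; lia.
Qed.

Lemma left_intervals_bound (k : nat) (t : btree) (p : nat * nat) :
  p \in left_intervals k t -> [/\ k <= p.1, p.1 < p.2 & p.2 < k + nleaves t].
Proof.
elim: t k => //= l IHl r IHr k; have := nleaves_gt0 l; have := nleaves_gt0 r.
by rewrite mem_cat => ? ? /orP[/intervals_bound|/IHr] []; split; lia.
Qed.

Lemma mem_left_intervals (k : nat) (t : btree) (p : nat * nat) :
  (p \in left_intervals k t) = (p \in intervals k t) && (p.2 != k + nleaves t).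
Proof.
elim: t k => [|l IHl r IHr] k /=.
  by rewrite inE; case: eqP => [->|//] /=; rewrite eqxx.
have r0 := nleaves_gt0 r.
rewrite inE !mem_cat IHr -addnA; case: (p =P (k, _)) => [->|_] /=.
  rewrite eqxx !andbF orbF; apply/negbTE/negP => /intervals_bound [] /=; lia.
case pl: (p \in intervals k l) => //=.
by have [_ _ ?] := intervals_bound pl; apply/esym/eqP; lia.
Qed.

Lemma intervals_uniq (k : nat) (t : btree) : uniq (intervals k t).
Proof.
elim: t k => //= l IHl r IHr k; rewrite cat_uniq IHl IHr andbT /= mem_cat.
have := nleaves_gt0 l; have := nleaves_gt0 r => r0 l0; apply/andP; split.
  by apply/negP => /orP[] /intervals_bound [] /=; lia.
by apply/hasPn => p /intervals_bound [? ? ?]; apply/negP => /intervals_bound []; lia.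
Qed.

Lemma left_intervals_uniq (k : nat) (t : btree) : uniq (left_intervals k t).
Proof.
elim: t k => //= l IHl r IHr k; rewrite cat_uniq intervals_uniq IHr andbT /=.
apply/hasPn => p /left_intervals_bound [? ? ?].
by apply/negP => /intervals_bound []; lia.
Qed.

Lemma size_intervals (k : nat) (t : btree) :
  (size (intervals k t)).+1 = (nleaves t).*2.
Proof.
elim: t k => //= l IHl r IHr k; rewrite size_cat.
have := IHl k; have := IHr (k + nleaves l); lia.
Qed.

(** Among the 2N - 1 vertices of a tree with N leaves, the right arm accounts for its length plus
    one. *)
Lemma size_left_intervals (k : nat) (t : btree) :
  (size (left_intervals k t) + right_arm_length t).+2 = (nleaves t).*2.
Proof.
elim: t k => //= l IHl r IHr k; rewrite size_cat.
have := size_intervals k l; have := IHr (k + nleaves l); lia.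
Qed.

Lemma left_intervals_singleton (k : nat) (t : btree) (i : nat) :
  k <= i -> i.+1 < k + nleaves t -> (i, i.+1) \in left_intervals k t.
Proof.
move=> ki it; rewrite mem_left_intervals /= neq_ltn it andbT.
have {}it : i < k + nleaves t by lia.
elim: t k ki it => [|l IHl r IHr] k ki it; rewrite inE.
  by rewrite /= in it; apply/eqP; congr pair; rewrite /=; lia.
rewrite mem_cat /= in it *; have [lt_i|le_i] := ltnP i (k + nleaves l).
  by rewrite IHl ?orbT.
by rewrite IHr ?orbT //; lia.
Qed.

(** The leaf set of [l] must occur in [l'] and that of [r] in [r'], which bounds the size of [l]
    from both sides; once the sizes agree, the inclusion splits into one for each child. *)
Lemma intervals_sub_inj (k : nat) (t t' : btree) :
  nleaves t = nleaves t' -> {subset intervals k t <= intervals k t'} -> t = t'.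
Proof.
elim: t k t' => [|l IHl r IHr] k [|l' r'] //= E sub.
- by have := nleaves_gt0 l'; have := nleaves_gt0 r'; lia.
- by have := nleaves_gt0 l; have := nleaves_gt0 r; lia.
have := (nleaves_gt0 l, nleaves_gt0 r, nleaves_gt0 l', nleaves_gt0 r').
move=> [[[l0 r0] l0'] r0'].
have subC p : p \in intervals k l ++ intervals (k + nleaves l) r ->
    p != (k, k + (nleaves l' + nleaves r')) ->
    (p \in intervals k l') || (p \in intervals (k + nleaves l') r').
  move=> pC /negPf np; have := sub p.
  by rewrite !inE pC orbT np mem_cat => /(_ isT).
have le1 : nleaves l <= nleaves l'.
  have := subC (k, k + nleaves l); rewrite mem_cat intervals_root => /(_ isT).
  case: eqP => [[]|_ /(_ isT)]; first lia.
  by case/orP => /intervals_bound [] /=; lia.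
have le2 : nleaves l' <= nleaves l.
  have := subC (k + nleaves l, k + nleaves l + nleaves r).
  rewrite mem_cat intervals_root orbT => /(_ isT).
  case: eqP => [[]|_ /(_ isT)]; first lia.
  by case/orP => /intervals_bound [] /=; lia.
have El : nleaves l = nleaves l' by lia.
congr Node; [apply: (IHl k) => // -[i j] pl | apply: (IHr (k + nleaves l))].
- have /= [? ? ?] := intervals_bound pl.
  have := subC (i, j); rewrite mem_cat pl => /(_ isT).
  case: eqP => [[]|_ /(_ isT)]; first lia.
  by case/orP => // /intervals_bound [] /=; lia.
- lia.
move=> [i j] pr; have /= [? ? ?] := intervals_bound pr.
have := subC (i, j); rewrite mem_cat pr orbT => /(_ isT).
case: eqP => [[]|_ /(_ isT)]; first lia.
by case/orP => [/intervals_bound [] /=|]; [lia | rewrite El].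
Qed.

(** Both right arms are followed until the left subtrees [l] and [l'] differ; there [l'] has more
    leaves than [l], and a rotation discards its leaf set only. *)
Lemma left_intervals_pred (k : nat) (t1 t2 : btree) :
    nleaves t1 = nleaves t2 -> t1 <> t2 ->
    {subset left_intervals k t1 <= left_intervals k t2} ->
  exists t, [/\ nleaves t = nleaves t2,
    {subset left_intervals k t1 <= left_intervals k t},
    {subset left_intervals k t <= left_intervals k t2} &
    right_arm_length t = (right_arm_length t2).+1].
Proof.
elim: t2 k t1 => [|l' _ r' IH] k [|l r] //= E ne sub.
- by have := nleaves_gt0 l; have := nleaves_gt0 r; lia.
- by have := nleaves_gt0 l'; have := nleaves_gt0 r'; lia.
have := (nleaves_gt0 l, nleaves_gt0 r, nleaves_gt0 l', nleaves_gt0 r').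
move=> [[[l0 r0] l0'] r0'].
have [lt_l|gt_l|El] := ltngtP (nleaves l) (nleaves l').
- case: l' => [|a b] in E ne sub l0' lt_l *; first by move: lt_l => /=; lia.
  exists (Node a (Node b r')); split=> [|p pt1|p|] //=; first by rewrite addnA.
    (* The discarded interval is not in [t1]: it starts at [k] and is longer than [l]. *)
    have := sub p pt1; rewrite /= !inE !mem_cat -!addnA -!orbA => /predU1P[Ep|//].
    move: pt1; rewrite Ep mem_cat; rewrite /= in lt_l.
    by case/orP => [/intervals_bound|/left_intervals_bound] [] /=; lia.
  by rewrite /= !inE !mem_cat -!addnA -!orbA => ->; rewrite orbT.
(* A larger [l] is impossible: its leaf set starts at [k] and is too long for [l']. *)
- have := sub (k, k + nleaves l); rewrite !mem_cat intervals_root => /(_ isT).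
  by case/orP => [/intervals_bound|/left_intervals_bound] [] /=; lia.
have Ell : l = l'.
  apply: (@intervals_sub_inj k) => // p pl; have [? ? ?] := intervals_bound pl.
  have := sub p; rewrite !mem_cat pl => /(_ isT).
  by case/orP => // /left_intervals_bound []; lia.
rewrite -{}Ell in E ne sub El *.
have [||p pr|t [Et sub1 sub2 Ea]] := IH (k + nleaves l) r.
- lia.
- by move=> Er; apply: ne; rewrite Er.
- have [? ? ?] := left_intervals_bound pr.
  have := sub p; rewrite !mem_cat pr orbT => /(_ isT).
  by case/orP => // /intervals_bound []; lia.
exists (Node l t); split=> /=; rewrite ?Et ?Ea // => p; rewrite !mem_cat.
  by case/orP => [->|/sub1 ->]; rewrite ?orbT.
by case/orP => [->|/sub2 ->]; rewrite ?orbT.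
Qed.

(** * The comb order in terms of intervals *)

Lemma nleaves_tree_of (n : nat) (T : tree_of n) : nleaves T = n.
Proof. by case: T => t /= /eqP. Qed.

Lemma ord_interval_inj (n : nat) (p q : nat * nat) :
    p.1 < p.2 -> p.2 <= n -> q.1 < q.2 -> q.2 <= n ->
  ord_interval n p = ord_interval n q -> p = q.
Proof.
case: p q => [i j] [i' j'] /= ij jn ij' jn' /setP E.
have mem x : x < n -> (i <= x < j) = (i' <= x < j').
  by move=> xn; have := E (Ordinal xn); rewrite !inE.
(* Nonempty intervals are compared at their first and last elements. *)
have := mem i; have := mem i'; have := mem j.-1; have := mem j'.-1.
by move=> *; congr pair; lia.
Qed.

Lemma mem_RP (n : nat) (T : tree_of n) (p : nat * nat) :
    p.1 < p.2 -> p.2 < n ->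
  (ord_interval n p \in RP T) = (p \in left_intervals 0 T).
Proof.
move=> p12 pn; rewrite inE leafsetsE mem_left_intervals add0n nleaves_tree_of.
have -> : [forall i in ord_interval n p, i.+1 != n].
  by apply/forall_inP => i; rewrite inE; lia.
rewrite (ltn_eqF pn) !andbT; apply/mapP/idP => [[q qT]|pT]; last by exists p.
have [_ q12] := intervals_bound qT; rewrite add0n nleaves_tree_of => qn.
by move/ord_interval_inj => -> //; apply: ltnW.
Qed.

Lemma RP_ord_interval (n : nat) (T : tree_of n) (A : {set 'I_n}) :
  A \in RP T -> exists2 p, p \in left_intervals 0 T & A = ord_interval n p.
Proof.
rewrite inE leafsetsE => /andP[/mapP[p pT ->] /forall_inP av]; exists p => //.
rewrite mem_left_intervals pT add0n nleaves_tree_of; apply/eqP => pn.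
have [_ p12 _] := intervals_bound pT.
(* An interval ending at [n] would contain [n.-1], the index of the forbidden last leaf. *)
have lt_n : n.-1 < n by lia.
by have := av (Ordinal lt_n); rewrite inE /= => /(_ ltac:(lia)); lia.
Qed.

(** Replaces sets of sets by lists of pairs, on which induction over trees is available. *)
Lemma comb_leP (n : nat) (T1 T2 : tree_of n) :
  reflect {subset left_intervals 0 T1 <= left_intervals 0 T2} (T1 <= T2)%O.
Proof.
have bnd (T : tree_of n) p : p \in left_intervals 0 T -> p.1 < p.2 /\ p.2 < n.
  by move=> /left_intervals_bound []; rewrite nleaves_tree_of.
apply: (iffP subsetP) => [sub p pT|sub A /RP_ord_interval [p pT ->]].
  have [? ?] := bnd _ _ pT.
  by rewrite -mem_RP //; apply: sub; rewrite mem_RP.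
by have [? ?] := bnd _ _ pT; rewrite mem_RP //; apply: sub.
Qed.

Lemma right_arm_lt (t : btree) : right_arm_length t < nleaves t.
Proof. elim: t => //= l _ r; have := nleaves_gt0 l; lia. Qed.

Lemma right_arm_length_gt0 (t : btree) : 1 < nleaves t -> 0 < right_arm_length t.
Proof. by case: t. Qed.

Lemma right_arm_right_comb (n : nat) : right_arm_length (right_comb n) = n.-1.
Proof. by elim: n => [|[|n] IH] //=; rewrite IH. Qed.

Lemma right_arm_left_comb (n : nat) : 1 < n -> right_arm_length (left_comb n) = 1.
Proof. by case: n => [|[|n]]. Qed.

Lemma left_intervals_right_comb (k n : nat) (p : nat * nat) :
  p \in left_intervals k (right_comb n) -> p.2 = p.1.+1.
Proof.
elim: n k => [|[|n] IH] k //=; rewrite inE => /predU1P[->|/IH //].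
by rewrite /= addn1.
Qed.

(** * Rank function, maximal elements and least element of the comb poset *)

Section CombPoset.
Variable n : nat.

(** This is the number of members of [RP T] with at least two leaves, since all [n - 1] allowed
    singletons belong to [RP T]. *)
Definition comb_rank (T : tree_of n) : nat := n.-1 - right_arm_length T.

Lemma comb_rankK (T : tree_of n) : comb_rank T + right_arm_length T = n.-1.
Proof.
by have := right_arm_lt T; rewrite nleaves_tree_of /comb_rank; lia.
Qed.

(** The size of [left_intervals] grows with the rank, so an inclusion without increase of rank is an
    equality of sets. *)
Lemma comb_rank_lt (T1 T2 : tree_of n) : (T1 < T2)%O -> comb_rank T1 < comb_rank T2.
Proof.
rewrite lt_leAnge => /andP[/comb_leP sub]; apply: contraR; rewrite -leqNgt => le_r.
have le_size : size (left_intervals 0 T2) <= size (left_intervals 0 T1).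
  have := size_left_intervals 0 T1; have := size_left_intervals 0 T2.
  rewrite !nleaves_tree_of; have := comb_rankK T1; have := comb_rankK T2; lia.
have [_ eqT] := uniq_min_size (left_intervals_uniq 0 T1) sub le_size.
by apply/comb_leP => p; rewrite eqT.
Qed.

Lemma comb_rank_pred (T1 T2 : tree_of n) : (T1 < T2)%O ->
  exists T, [/\ T1 <= T, T < T2 & comb_rank T2 = (comb_rank T).+1]%O.
Proof.
rewrite lt_neqAle => /andP[/eqP ne /comb_leP sub].
have [||t [Et sub1 sub2 Ea]] := left_intervals_pred _ _ sub.
- by rewrite !nleaves_tree_of.
- by move=> /val_inj.
have tn : nleaves t == n by rewrite Et nleaves_tree_of.
have ET : comb_rank T2 = (comb_rank (TreeOf tn)).+1.
  by have := comb_rankK T2; have := comb_rankK (TreeOf tn); rewrite /= Ea; lia.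
exists (TreeOf tn); split=> //; first exact/comb_leP.
rewrite lt_neqAle (introT (comb_leP (TreeOf tn) T2) sub2) andbT.
by apply: contra_eq_neq ET => ->; lia.
Qed.

(** A tree with right arm of length 1 has the largest possible rank. A longer arm gives a tree l (a
    b), strictly below its rotation (l a) b. *)
Lemma is_maximal_right_arm (T : tree_of n) :
  1 < n -> is_maximal T <-> right_arm_length T = 1.
Proof.
move=> n_gt1; split=> [maxT|arm1 T' le_T]; last first.
  apply/eqP; apply: contraT; rewrite eq_sym => ne.
  have /comb_rank_lt : (T < T')%O by rewrite lt_neqAle ne.
  have := comb_rankK T; have := comb_rankK T'.
  have := @right_arm_length_gt0 T'; rewrite nleaves_tree_of arm1; lia.
case: T maxT => [[|l [|a b]] tn] maxT //; first by move: (eqP tn) => /=; lia.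
have tn' : nleaves (Node (Node l a) b) == n by rewrite /= -addnA.
have /maxT : (TreeOf tn <= TreeOf tn' :> tree_of n)%O.
  apply/comb_leP => p.
  by rewrite /= !inE !mem_cat -!addnA -!orbA => ->; rewrite orbT.
case=> /(congr1 nleaves) /=; have := nleaves_gt0 a; lia.
Qed.

Hypothesis n_gt0 : 0 < n.

(** The right comb contributes only singletons, and these belong to every [RP T]. *)
Lemma RCT_le (T : tree_of n) : (RCT n_gt0 <= T)%O.
Proof.
apply/comb_leP => p pR; have := left_intervals_bound pR.
rewrite nleaves_tree_of; have /= := left_intervals_right_comb pR.
by case: p {pR} => i j /= -> [_ _ lt_n]; apply: left_intervals_singleton;
   rewrite ?nleaves_tree_of.
Qed.

Lemma comb_rank_RCT : comb_rank (RCT n_gt0) = 0.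
Proof. by rewrite /comb_rank right_arm_right_comb subnn. Qed.

Lemma ranked_from_RCT : ranked_from (RCT n_gt0).
Proof.
exact: ranked_from_rho RCT_le comb_rank_lt comb_rank_RCT comb_rank_pred.
Qed.

Lemma rank_from_RCT (T : tree_of n) : rank_from (RCT n_gt0) T = comb_rank T.
Proof.
exact: (rank_from_rho RCT_le comb_rank_lt comb_rank_RCT comb_rank_pred).
Qed.

End CombPoset.

(** * Enumeration of the trees of a given rank *)

(** Only its values on trees with right arm of length at least 2 matter; there it is injective,
    shortens the arm by one and so raises the rank by one. *)
Definition rotate_right (t : btree) : btree :=
  if t is Node a (Node b r) then Node (Node a b) r else t.

(* The trees with m + 1 leaves whose right arm has length m - r. *)
Fixpoint trees_of_rank (m : nat) : nat -> seq btree :=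
  if m is m'.+1 then
    fix aux (r : nat) : seq btree :=
      map (Node Leaf) (trees_of_rank m' r) ++
      (if r is s.+1 then
         if s < m' then map rotate_right (aux s) else [::]
       else [::])
  else fun r => if r is 0 then [:: Leaf] else [::].

(** This is the recurrence for f. The guard [s < m] says that the arm length [m.+1 - s] of the trees
    to be rotated is at least 2. *)
Lemma trees_of_rankSS (m s : nat) :
  trees_of_rank m.+1 s.+1 =
  map (Node Leaf) (trees_of_rank m s.+1) ++
  (if s < m then map rotate_right (trees_of_rank m.+1 s) else [::]).
Proof. by []. Qed.

Lemma mem_trees_of_rank (m r : nat) (t : btree) :
  (t \in trees_of_rank m r) =
  (nleaves t == m.+1) && (right_arm_length t + r == m).
Proof.
elim: m r t => [|m IHm] r t.
  case: r => [|r] /=; last by rewrite in_nil addnS andbF.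
  by rewrite inE; case: t => //= l r; rewrite addSn andbF; apply/eqP.
have LeafE s u : (Node Leaf u \in map (Node Leaf) (trees_of_rank m s)) =
    (nleaves (Node Leaf u) == m.+2) && (right_arm_length (Node Leaf u) + s == m.+1).
  by rewrite mem_map => [|? ? []//]; rewrite IHm /=; lia.
have notLeaf s u : (if u is Node Leaf _ then False else True) ->
    u \in map (Node Leaf) (trees_of_rank m s) = false.
  by move=> Hu; apply/negP => /mapP [v _ Eu]; rewrite Eu in Hu.
elim: r t => [|s IHs] t.
  (* In rank 0 the left subtree is a leaf: otherwise too few leaves remain for an arm of length
     [m.+1]. *)
  rewrite [trees_of_rank _ _]/= cats0; case: t => [|[|a b] u]; first exact: notLeaf.
    exact: LeafE.
  rewrite notLeaf // addn0 /=; have := right_arm_lt u.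
  by have := nleaves_gt0 a; have := nleaves_gt0 b; lia.
rewrite trees_of_rankSS mem_cat.
have rotE u : s < m -> u \in map rotate_right (trees_of_rank m.+1 s) ->
    exists a b r, u = Node (Node a b) r /\
      Node a (Node b r) \in trees_of_rank m.+1 s.
  move=> lt_s /mapP [v vs ->]; move: (vs); rewrite IHs => /andP[_ /eqP].
  by case: v vs => [|a [|b r]] /=; try lia; move=> vs _; exists a, b, r.
case: t => [|[|a b] u].
- rewrite notLeaf //=; case: ifP => // lt_s.
  by apply/negbTE/negP => /(rotE _ lt_s) [? [? [? []]]].
- rewrite LeafE orbC; case: ifP => // lt_s.
  case R: (_ \in map rotate_right _) => //=.
  by have [? [? [? []]]] := rotE _ lt_s R.
rewrite notLeaf //=; case: ifP => [lt_s|ge_s]; last first.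
  by rewrite in_nil; apply/esym/negbTE; rewrite negb_and; lia.
(* The only possible preimage under the rotation has rank [s], where the inner induction applies. *)
transitivity (Node a (Node b u) \in trees_of_rank m.+1 s).
  apply/idP/idP => [/(rotE _ lt_s) [? [? [? [[-> -> ->]]]]] //|vs].
  by apply/mapP; exists (Node a (Node b u)).
by rewrite IHs /=; lia.
Qed.

(** The two parts of the list are disjoint because a rotated tree never has a leaf as left child. *)
Lemma trees_of_rank_uniq (m r : nat) : uniq (trees_of_rank m r).
Proof.
elim: m r => [[]|m IHm] // r.
have uniqL s : uniq (map (Node Leaf) (trees_of_rank m s)).
  by rewrite map_inj_uniq // => ? ? [].
elim: r => [|s IHs]; first by rewrite /= cats0.
rewrite trees_of_rankSS; case: ifP => lt_s; last by rewrite cats0.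
have armE t : t \in trees_of_rank m.+1 s -> exists a b r, t = Node a (Node b r).
  rewrite mem_trees_of_rank => /andP[_ /eqP].
  by case: t => [|a [|b r]] /=; try lia; exists a, b, r.
rewrite cat_uniq uniqL map_inj_in_uniq ?IHs ?andbT /=.
  apply/hasPn => _ /mapP [t /armE [a [b [r ->]]] ->].
  by apply/negP => /mapP [].
by move=> t u /armE [a [b [r ->]]] /armE [a' [b' [r' ->]]] [-> -> ->].
Qed.

(** The ballot formula in additive form, free of truncated subtraction between binomials. *)
Lemma size_trees_of_rank (m r : nat) : r <= m ->
  size (trees_of_rank m r) + bin_pred (m + r - 1) r = 'C(m + r - 1, r).
Proof.
elim: m r => [[]|m IHm] // r.
elim: r => [|s IHs] le_s.
  by rewrite /= cats0 size_map; have := IHm 0 isT; rewrite /= !bin0.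
rewrite trees_of_rankSS size_cat size_map [bin_pred _ _]/=.
have [lt_s|ge_s] := ltnP s m; last first.
  (* At the boundary rank [m.+1] the arm would have length 0, so there is no tree; the two binomials
     agree by symmetry. *)
  have {le_s ge_s} -> : s = m by lia.
  have -> : trees_of_rank m m.+1 = [::].
    case E: (trees_of_rank m m.+1) => [|t ts] //.
    by have := mem_head t ts; rewrite -E mem_trees_of_rank; lia.
  by rewrite -[RHS]bin_sub; [congr 'C(_, _) | ]; lia.
rewrite size_map.
(* The two induction hypotheses add up to the goal after Pascal's rule is applied to both
   binomials. *)
have := IHm s.+1 lt_s; have := IHs ltac:(lia).
have -> : m.+1 + s - 1 = m + s by lia.
have -> : m + s.+1 - 1 = m + s by lia.
have -> : m.+1 + s.+1 - 1 = (m + s).+1 by lia.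
rewrite binS [bin_pred _ _.+1]/=.
have -> : 'C((m + s).+1, s) = 'C(m + s, s) + bin_pred (m + s) s.
  by case: (s) => [|s'] /=; rewrite ?bin0 // binS.
lia.
Qed.

Lemma card_trees_of_rank (n r : nat) : 0 < n ->
  #|[set T : tree_of n | comb_rank T == r]| = size (trees_of_rank n.-1 r).
Proof.
move=> n_gt0; rewrite cardE -(size_map (@Defs.shape n)); apply/perm_size/uniq_perm.
- by rewrite map_inj_uniq ?enum_uniq //; apply: val_inj.
- exact: trees_of_rank_uniq.
move=> t; rewrite mem_trees_of_rank prednK //; apply/mapP/andP.
  case=> T; rewrite mem_enum inE => /eqP rT ->; rewrite nleaves_tree_of.
  by have := comb_rankK T; rewrite rT => <-; rewrite addnC.
case=> tn /eqP arm_t; exists (TreeOf tn) => //; rewrite mem_enum inE.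
by apply/eqP; rewrite /comb_rank /= -arm_t addKn.
Qed.

Theorem theorem3p2 (n : nat) (n_ge3 : 3 <= n) :
  let n_gt0 : 0 < n := ltnW (ltnW n_ge3) in
  let rank (T : tree_of n) : nat := rank_from (RCT n_gt0) T in
  [/\ ranked_from (RCT n_gt0),
      (forall T : tree_of n, is_maximal T <-> rank T = n - 2),
      (forall T : tree_of n, is_maximal T <-> right_arm_length T = 1),
      rank (LCT n_gt0) = n - 2 /\
        (forall T : tree_of n, rank T <= rank (LCT n_gt0)) &
      forall r : nat, r <= n - 2 ->
        (#|Q n_gt0 r|%:Z = 'C(n + r - 2, r)%:Z - (bin_pred (n + r - 2) r)%:Z)%R].
Proof.
move=> n_gt0 rank; have rankE T : rank T = comb_rank T := rank_from_RCT n_gt0 T.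
have maxE (T : tree_of n) : is_maximal T <-> right_arm_length T = 1.
  by apply: is_maximal_right_arm; lia.
have arm_gt0 (T : tree_of n) : 0 < right_arm_length T.
  by apply: right_arm_length_gt0; rewrite nleaves_tree_of; lia.
have rank_LCT : rank (LCT n_gt0) = n - 2.
  by rewrite rankE /comb_rank right_arm_left_comb; lia.
split; [exact: ranked_from_RCT | | exact: maxE | split; first exact: rank_LCT |].
(* Rank and arm length add up to [n - 1], so rank [n - 2] means arm length 1. *)
- by move=> T; rewrite maxE rankE; have := comb_rankK T; split; lia.
- move=> T; rewrite rank_LCT rankE.
  by have := comb_rankK T; have := arm_gt0 T; lia.
move=> r le_r; have -> : n + r - 2 = n.-1 + r - 1 by lia.
have -> : #|Q n_gt0 r| = size (trees_of_rank n.-1 r).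
  rewrite -card_trees_of_rank //.
  by apply: eq_card => T; rewrite !inE -rankE.
by rewrite -size_trees_of_rank ?PoszD ?GRing.addrK //; lia.
Qed.
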